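(* Let $\phi:\mathcal{H}\rightarrow\mathbb{R}$ be a convex and continuous function and let $\{\lambda_k\}_{k=0}^{\infty}\subset[\varepsilon,1+\rho_{\{U_i\}_{i=1}^m}-\varepsilon]$, where $\varepsilon>0$, be a sequence of positive numbers. Let $x^0\in\mathcal{H}$ and let $\{x^k\}_{k=0}^{\infty}$ be the sequence generated by the basic algorithm (defined in the context) with respect to $\{\lambda_k\}_{k=0}^{\infty}$, and suppose that it converges strongly to a point $x\in C$. Suppose that the sequence $\{y^k\}_{k=0}^{\infty}$, generated by the corresponding superiorized algorithm (defined in the context, with the same operators, the same $\{\lambda_k\}_{k=0}^\infty$ and the function $\phi$), converges strongly to a point $y\in C$. Suppose that there exists a strictly increasing sequence $\{\gamma_k\}_{k=0}^\infty$ of natural numbers such that for each $k\in\mathbb{N}$ the parameters $\{\{\beta_{k,n}\}_{n=1}^{N_k}\}_{k=0}^\infty$ are such that $$\left\langle y^{\gamma_k}-T_{(\Omega_{\gamma_k},\omega_{\gamma_k})\lambda_{\gamma_k}}\left(x^{\gamma_k}\right),\;y^{\gamma_k}-T_{(\Omega_{\gamma_k},\omega_{\gamma_k})\lambda_{\gamma_k}}\Big(y^{\gamma_k}+\sum_{n=1}^{N_{\gamma_k}}\beta_{\gamma_k,n}v^{\gamma_k,n}\Big)\right\rangle\le\left\langle y^{\gamma_k}-x^{\gamma_k},\;x^{\gamma_k}-T_{(\Omega_{\gamma_k},\omega_{\gamma_k})\lambda_{\gamma_k}}\left(x^{\gamma_k}\right)\right\rangle.$$ Then $\phi(y)\le\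phi(x)$.
   Context: $\mathbb{N}$ starts from $0$. $\mathcal{H}$ is a real Hilbert space with inner product $\langle\cdot,\cdot\rangle$ and induced norm $\|\cdot\|$; $Id$ is the identity operator; $\mathrm{Fix}\,T:=\{x\in\mathcal{H}\mid T(x)=x\}$. For an operator $T:\mathcal{H}\to\mathcal{H}$ and $\lambda\in[0,2]$, the $\lambda$-relaxation of $T$ is $T_\lambda:=(1-\lambda)Id+\lambda T$. An operator $T$ is firmly nonexpansive if $\langle T(x)-T(y),x-y\rangle\ge\|T(x)-T(y)\|^2$ for all $x,y\in\mathcal{H}$; it is $\lambda$-relaxed firmly nonexpansive if $T=U_\lambda$ for some firmly nonexpansive $U$. For convex $\phi:\mathcal{H}\to\mathbb{R}$, the subdifferential at $x$ is $\partial\phi(x):=\{g\in\mathcal{H}\mid\langle g,y-x\rangle\le\phi(y)-\phi(x)\text{ for all }y\in\mathcal{H}\}$; it is nonempty for every $x$ when $\phi$ is convex and continuous. For a sequence of sets, $\limsup_{k\to\infty}A_k:=\bigcap_{n=0}^\infty\bigcup_{k=n}^\infty A_k$. Setting. Let $m$ be a positive integer and, for each $i=1,\dots,m$, let $U_i:\mathcal{H}\to\mathcal{H}$ be $\alpha_i$-relaxed firmly nonexpansive with $\alpha_i\in(0,2]$. Let $\{q_k\}_{k=0}^\infty$ be a bounded sequence of positive integers, $\mathcal{M}:=\max_{k\in\mathbb{N}}q_k$, and $$\rho_{\{U_i\}_{i=1}^m}:=\min\left\{\mathcal{M}^{-1}\min_{i\in\{1,\dots,m\}}(2-\alpha_i)\alpha_i^{-1},\,1\right\}.$$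 For each $k\in\mathbb{N}$, let $\Omega_k$ be a nonempty set of functions from $\{1,\dots,q_k\}$ to $\{1,\dots,m\}$; for $t\in\Omega_k$ put $V_k[t]:=U_{t(q_k)}\cdots U_{t(2)}U_{t(1)}$ (composition); let $\omega_k:\Omega_k\to(0,1]$ satisfy $\sum_{t\in\Omega_k}\omega_k(t)=1$; and define $T_{(\Omega_k,\omega_k)}:=\sum_{t\in\Omega_k}\omega_k(t)V_k[t]$. The operator $T_{(\Omega_k,\omega_k)\lambda_k}$ is the $\lambda_k$-relaxation of $T_{(\Omega_k,\omega_k)}$, i.e. $(1-\lambda_k)Id+\lambda_kT_{(\Omega_k,\omega_k)}$. Let $I:=\limsup_{k\to\infty}\{T_{(\Omega_k,\omega_k)}\}$ (the limsup of the sequence of singletons) and $C:=\bigcap_{T\in I}\mathrm{Fix}\,T$ (with $C=\mathcal{H}$ if $I=\emptyset$). Basic algorithm. Given $x^0\in\mathcal{H}$ and $\lambda_k\in[\varepsilon,1+\rho_{\{U_i\}_{i=1}^m}-\varepsilon]$ for each $k\in\mathbb{N}$ (with $\varepsilon\in(0,1]$), $$x^{k+1}:=x^k+\lambda_k\left(T_{(\Omega_k,\omega_k)}(x^k)-x^k\right),\quad k\in\mathbb{N}.$$ Superiorized algorithm. Given $y^0\in\mathcal{H}$, a sequence $\{N_k\}_{k=0}^\infty$ of positive integers, the positive numbers $\{\lambda_k\}_{k=0}^\infty$, and positive reals $\beta_{k,n}$ ($k\in\mathbb{N}$, $1\le n\le N_k$) with $\sum_{k=0}^\infty\sum_{n=1}^{N_k}\beta_{k,n}<\infty$,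 $$y^{k+1}:=y^k+\sum_{n=1}^{N_k}\beta_{k,n}v^{k,n}+\lambda_k\left(T_{(\Omega_k,\omega_k)}\Big(y^k+\sum_{n=1}^{N_k}\beta_{k,n}v^{k,n}\Big)-y^k-\sum_{n=1}^{N_k}\beta_{k,n}v^{k,n}\right),$$ where, for each $k\in\mathbb{N}$ and $n=0,1,\dots,N_k-1$, $s^{k,n}$ is a selected element of $\partial\phi\big(y^k+\sum_{i=1}^{n}\beta_{k,i}v^{k,i}\big)$ (empty sums are $0$), and $v^{k,n+1}:=-\|s^{k,n}\|^{-1}s^{k,n}$ if $0\notin\partial\phi\big(y^k+\sum_{i=1}^{n}\beta_{k,i}v^{k,i}\big)$, while $v^{k,n+1}:=0$ if $0\in\partial\phi\big(y^k+\sum_{i=1}^{n}\beta_{k,i}v^{k,i}\big)$. *)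

(* Defs.v *)
From HB Require Import structures.
From mathcomp Require Export all_boot all_order all_algebra.
From mathcomp Require Export sesquilinear.
From mathcomp Require Export all_classical all_reals all_analysis.

Set Implicit Arguments.
Unset Strict Implicit.
Unset Printing Implicit Defensive.

Import Order.TTheory GRing.Theory Num.Theory.
Import numFieldNormedType.Exports.

Local Open Scope classical_set_scope.
Local Open Scope ring_scope.

(* A real Hilbert space is a complete normed space H over R : realType together
   with an inner product ip : {dot H for idfun} that induces its norm. *)
Definition induces_norm (R : realType) (H : completeNormedModType R)
    (ip : {dot H for idfun}) : Prop :=
  forall x : H, `|x| = Num.sqrt (ip x x).

Definition Fix (T : Type) (f : T -> T) : set T := [set x | f x = x].

Definition relaxation (R : realType) (H : lmodType R) (lambda : R)
    (T : H -> H) : H -> H :=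
  fun x => (1 - lambda) *: x + lambda *: T x.

Definition firmly_nonexpansive (R : realType) (H : completeNormedModType R)
    (ip : {dot H for idfun}) (T : H -> H) : Prop :=
  forall x y : H, `|T x - T y| ^+ 2 <= ip (T x - T y) (x - y).

Definition relaxed_firmly_nonexpansive (R : realType)
    (H : completeNormedModType R) (ip : {dot H for idfun}) (lambda : R)
    (T : H -> H) : Prop :=
  exists U : H -> H, firmly_nonexpansive ip U /\ T = relaxation lambda U.

Definition subdifferential (R : realType) (H : completeNormedModType R)
    (ip : {dot H for idfun}) (phi : H -> R) (x : H) : set H :=
  [set g | forall y : H, ip g (y - x) <= phi y - phi x].

(* Junk value 0 if the sequence is unbounded. *)
Definition max_seq (q : nat -> nat) : nat :=
  xget 0%N [set M | (exists k, q k = M) /\ (forall k, (q k <= M)%N)].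

(* The default element of the iterated minimum is one of the values, so this is
   the minimum of the finite nonempty family r itself. *)
Definition rho (R : realType) (m : nat) (alpha : 'I_m.+1 -> R)
    (q : nat -> nat) : R :=
  let r i := (2 - alpha i) * (alpha i)^-1 in
  Num.min ((max_seq q)%:R^-1 * \big[Num.min/r ord0]_(i < m.+1) r i) 1.

(* U_{t(q)} o ... o U_{t(1)}: the operator of the first index acts first. *)
Definition string_op (T : Type) (I : Type) (U : I -> T -> T) (q : nat)
    (t : 'I_q -> I) : T -> T :=
  fun x => foldl (fun z j => U (t j) z) x (enum 'I_q).

Definition string_avg (R : realType) (H : lmodType R) (m q : nat)
    (U : 'I_m.+1 -> H -> H) (Omega : {set {ffun 'I_q -> 'I_m.+1}})
    (omega : {ffun 'I_q -> 'I_m.+1} -> R) : H -> H :=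
  fun x => \sum_(t in Omega) omega t *: string_op U t x.

(* Only the values of omega on Omega are relevant. *)
Definition is_weight (R : realType) (I : finType) (Omega : {set I})
    (omega : I -> R) : Prop :=
  (forall t, t \in Omega -> 0 < omega t <= 1) /\
  \sum_(t in Omega) omega t = 1.

Definition common_fix (T : Type) (Top : nat -> T -> T) : set T :=
  \bigcap_(S in lim_sup_set (fun k => [set Top k])) Fix S.

Definition basic_algorithm (R : realType) (H : lmodType R)
    (Top : nat -> H -> H) (lambda : nat -> R) (x0 : H) (x : nat -> H) : Prop :=
  x 0%N = x0 /\
  forall k, x k.+1 = x k + lambda k *: (Top k (x k) - x k).

(* The inner iterate y^k + sum_{i=1}^n beta_{k,i} v^{k,i}. *)
Definition perturbed (R : realType) (H : lmodType R) (beta : nat -> nat -> R)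
    (v : nat -> nat -> H) (y : nat -> H) (k n : nat) : H :=
  y k + \sum_(1 <= i < n.+1) beta k i *: v k i.

(* beta k n and v k n are only relevant for 1 <= n <= N k,
   and s k n for 0 <= n < N k. *)
Record superiorized_algorithm (R : realType) (H : completeNormedModType R)
    (ip : {dot H for idfun}) (phi : H -> R) (Top : nat -> H -> H)
    (lambda : nat -> R) (N : nat -> nat) (beta : nat -> nat -> R)
    (s v : nat -> nat -> H) (y0 : H) (y : nat -> H) : Prop := {
  superiorized_N_gt0 : forall k, (0 < N k)%N;
  superiorized_beta_gt0 : forall k n, (1 <= n <= N k)%N -> 0 < beta k n;
  superiorized_beta_summable :
    cvgn (series (fun k => \sum_(1 <= n < (N k).+1) beta k n));
  superiorized_subgradient : forall k n, (n < N k)%N ->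
    subdifferential ip phi (perturbed beta v y k n) (s k n);
  superiorized_direction : forall k n, (n < N k)%N ->
    ~ subdifferential ip phi (perturbed beta v y k n) 0 ->
    v k n.+1 = - (`|s k n|^-1 *: s k n);
  superiorized_direction0 : forall k n, (n < N k)%N ->
    subdifferential ip phi (perturbed beta v y k n) 0 ->
    v k n.+1 = 0;
  superiorized_init : y 0%N = y0;
  superiorized_step : forall k,
    y k.+1 = perturbed beta v y k (N k) +
      lambda k *: (Top k (perturbed beta v y k (N k))
                   - perturbed beta v y k (N k)) }.

(* Main.v *)
Require Import Defs.
From mathcomp Require Import all_boot all_order all_algebra.
From mathcomp Require Import sesquilinear ring lra.
From mathcomp Require Import all_classical all_reals all_analysis.
Import Order.TTheory GRing.Theory Num.Theory.
Import numFieldNormedType.Exports.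
Local Open Scope classical_set_scope.
Local Open Scope ring_scope.

(** Write [T_k] for the relaxed operators, which are nonexpansive, and [z^k] for
    the perturbation of [y^k]. If [phi x < phi y], then near [y] each
    perturbation strictly decreases the distance to every point near [x],
    because a subgradient there makes a uniformly obtuse angle with the
    directions towards a ball around [x]; hence
    [|T_k z^k - T_k x^k| <= |z^k - x^k| < |y^k - x^k|] for large [k]. But
    expanding the square shows that the hypothesis on the indices [gamma_k]
    means that [|T_k z^k - T_k x^k| >= |y^k - x^k|] for these indices. *)

Section InnerProduct.
Context (R : realType) (H : completeNormedModType R) (ip : {dot H for idfun}).
Hypothesis ip_norm : induces_norm ip.

(** * Real inner product calculus *)

Lemma ipC u v : ip u v = ip v u.
Proof. by rewrite [LHS]hermC /= expr0 mul1r. Qed.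

Lemma ipDl u v w : ip (u + v) w = ip u w + ip v w.
Proof. exact: linearDl. Qed.

Lemma ipDr u v w : ip w (u + v) = ip w u + ip w v.
Proof. exact: linearDr. Qed.

Lemma ipNl u w : ip (- u) w = - ip u w.
Proof. exact: linearNl. Qed.

Lemma ipNr u w : ip w (- u) = - ip w u.
Proof. exact: linearNr. Qed.

Lemma ipZl a u w : ip (a *: u) w = a * ip u w.
Proof. exact: linearZl_LR. Qed.

Lemma ipZr a u w : ip w (a *: u) = a * ip w u.
Proof. exact: linearZr_LR. Qed.

Lemma ip_ge0 u : 0 <= ip u u.
Proof.
have [->|/neq0_dnorm_gt0 u_gt0] := eqVneq u 0; first by rewrite linear0l.
by rewrite ltW.
Qed.

Lemma sqr_normE u : `|u| ^+ 2 = ip u u.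
Proof. by rewrite ip_norm sqr_sqrtr ?ip_ge0. Qed.

Let ipE := (ipDl, ipDr, ipNl, ipNr, ipZl, ipZr).

Lemma ler_norm_ip u v : (`|u| <= `|v|) = (ip u u <= ip v v).
Proof. by rewrite -!sqr_normE ler_sqr ?nnegrE. Qed.

Lemma ltr_norm_ip u v : (`|u| < `|v|) = (ip u u < ip v v).
Proof. by rewrite -!sqr_normE ltr_sqr ?nnegrE. Qed.

(** * Cocoercivity of [Id - T] under relaxation, composition and averaging *)

Definition residual (T : H -> H) x y : H := (x - y) - (T x - T y).

(* Cocoercivity of [Id - T] with constant [(1 + r) / 2]: a form that, unlike that
   of [cocoercive_residualP], is visibly stable under convex combinations. *)
Definition cocoercive_residual (r : R) (T : H -> H) :=
  forall x y, (1 + r) * ip (residual T x y) (residual T x y)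
              <= 2 * ip (x - y) (residual T x y).

(** The second form suits compositions: its right-hand side is a loss of squared distance, which
    telescopes. *)
Lemma cocoercive_residualP r T x y :
  (1 + r) * ip (residual T x y) (residual T x y)
    <= 2 * ip (x - y) (residual T x y) <->
  r * ip (residual T x y) (residual T x y)
    <= ip (x - y) (x - y) - ip (T x - T y) (T x - T y).
Proof.
rewrite /residual; move: (x - y) (T x - T y) => a b.
rewrite !ipE (ipC b a); split; lra.
Qed.

Lemma cocoercive_residual_le {r1 r2 : R} {T} : r1 <= r2 ->
  cocoercive_residual r2 T -> cocoercive_residual r1 T.
Proof.
move=> le_r T2 x y; apply: le_trans (T2 x y).
by rewrite ler_wpM2r ?ip_ge0// lerD2l.
Qed.

Lemma relaxationB lambda T x y :
  relaxation lambda T x - relaxation lambda T y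
  = (x - y) - lambda *: residual T x y.
Proof.
have E z : relaxation lambda T z = z - lambda *: (z - T z).
  by rewrite /relaxation scalerBl scale1r scalerBr opprB addrA addrAC.
have -> : residual T x y = (x - T x) - (y - T y).
  by rewrite /residual !opprD !opprK addrACA.
rewrite !E; move: (x - T x) (y - T y) => u w.
by rewrite scalerBr !opprD !opprK addrACA.
Qed.

(** Relaxing multiplies the residual by [alpha], and [1 + (2 - alpha) / alpha = 2 / alpha]; what
    remains is firm nonexpansiveness of [Id - U], equivalent to that of [U]. *)
Lemma relaxed_firmly_nonexpansive_residual alpha T :
  0 < alpha -> relaxed_firmly_nonexpansive ip alpha T ->
  cocoercive_residual ((2 - alpha) * alpha^-1) T.
Proof.
move=> alpha_gt0 [U [Ufne ->]] x y.
have -> : residual (relaxation alpha U) x y = alpha *: residual U x y.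
  by rewrite {1}/residual relaxationB subKr.
have := Ufne x y; rewrite sqr_normE /residual.
move: (x - y) (U x - U y) => a b ab.
have -> : 1 + (2 - alpha) * alpha^-1 = 2 / alpha.
  by field; rewrite gt_eqF.
rewrite !ipZr ipZl.
have -> : 2 / alpha * (alpha * (alpha * ip (a - b) (a - b)))
  = alpha * (2 * ip (a - b) (a - b)) by field; rewrite gt_eqF.
rewrite mulrCA ler_pM2l // ler_pM2l //.
by rewrite !ipE (ipC b a) in ab *; lra.
Qed.

(** The residual of a composition is the sum of the residuals of its factors, so convexity of the
    squared norm costs a factor equal to their number, while the losses of squared distance add
    up. *)
Lemma foldl_residual {I : Type} {U : I -> H -> H} {r : R} :
  (forall i, cocoercive_residual r (U i)) -> 0 <= r ->
  forall (s : seq I) x y,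
  let F := fun z => foldl (fun z i => U i z) z s in
  r * ip (residual F x y) (residual F x y)
    <= (size s)%:R * (ip (x - y) (x - y) - ip (F x - F y) (F x - F y)).
Proof.
move=> Ur r_ge0; elim=> [|i s IH] x y /=.
  by rewrite /residual /= subrr linear0l mulr0 mul0r.
have /cocoercive_residualP := Ur i x y.
have [/size0nil ->|s_neq0] := eqVneq (size s) 0%N.
  by rewrite /= mul1r.
have := IH (U i x) (U i y); rewrite /=; set F := fun z => foldl _ z s.
rewrite -/(F (U i x)) -/(F (U i y)).
have -> : residual (fun z => F (U i z)) x y
        = residual (U i) x y + residual F (U i x) (U i y).
  by rewrite /residual addrA subrK.
move: (x - y) (U i x - U i y) (F _ - F _) => a b c.
move: (residual (U i) x y) (residual F _ _) => d e.
have n_gt0 : 0 < (size s)%:R :> R by rewrite ltr0n lt0n.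
rewrite -natr1; move: (size s)%:R n_gt0 => n n_gt0 leE leD.
(* This square encodes [|d + e|^2 <= (n + 1) (|d|^2 + |e|^2 / n)], the convexity bound with weights
   1 and [n]; hence the empty tail was treated apart. *)
have : 0 <= r * ip (n *: d - e) (n *: d - e) by rewrite mulr_ge0 ?ip_ge0.
rewrite !ipE (ipC e d) => ge0.
rewrite -(ler_pM2l n_gt0).
have : n * (n + 1) * (r * ip d d) <= n * (n + 1) * (ip a a - ip b b).
  by rewrite ler_pM2l // mulr_gt0 // addr_gt0.
have : (n + 1) * (r * ip e e) <= (n + 1) * (n * (ip b b - ip c c)).
  by rewrite ler_pM2l // addr_gt0.
lra.
Qed.

Lemma string_op_residual {I : Type} {U : I -> H -> H} {r : R} {q : nat}
    (t : 'I_q -> I) : (0 < q)%N -> 0 <= r ->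
  (forall i, cocoercive_residual (q%:R * r) (U i)) ->
  cocoercive_residual r (string_op U t).
Proof.
move=> q_gt0 r_ge0 Ur x y; apply/cocoercive_residualP.
have qr_ge0 : 0 <= q%:R * r by rewrite mulr_ge0.
have := foldl_residual (fun j => Ur (t j)) qr_ge0 (enum 'I_q) x y.
rewrite size_enum_ord /= -/(string_op U t) -mulrA ler_pM2l//.
by rewrite ltr0n.
Qed.

Lemma weighted_sum_residual {I : finType} {Omega : {set I}} {omega : I -> R}
    {V : I -> H -> H} {r : R} : 0 <= 1 + r -> is_weight Omega omega ->
  (forall t, cocoercive_residual r (V t)) ->
  cocoercive_residual r (fun x => \sum_(t in Omega) omega t *: V t x).
Proof.
move=> r_ge [omega_itv omega1] Vr x y.
(* The squared norm lies above its tangent at [u]. Taking [u] to be the averaged residual [d] and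
   averaging over [t] gives Jensen's inequality. *)
have tangent u w : 2 * ip u w - ip u u <= ip w w.
  by have := ip_ge0 (u - w); rewrite !ipE (ipC w u); lra.
set F := fun x => _; set d := residual F x y.
have dE : d = \sum_(t in Omega) omega t *: residual (V t) x y.
  rewrite (eq_bigr _ (fun t _ => scalerBr _ _ _)) big_split /= sumrN.
  rewrite -scaler_suml omega1 scale1r; congr (_ - _).
  by rewrite -sumrB; apply: eq_bigr => t _; rewrite scalerBr.
have ipdE u : ip u d = \sum_(t in Omega) omega t * ip u (residual (V t) x y).
  rewrite dE (big_morph (ip u) (fun a b => ipDr a b u) (linear0r ip u)).
  by apply: eq_bigr => t _; rewrite ipZr.
have : \sum_(t in Omega) omega t * ((1 + r) * (2 * ip d (residual (V t) x y)
         - ip d d))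
       <= \sum_(t in Omega) omega t * (2 * ip (x - y) (residual (V t) x y)).
  apply: ler_sum => t /omega_itv/andP[omega_gt0 _]; rewrite ler_pM2l//.
  apply: le_trans (Vr t x y); exact: ler_wpM2l.
rewrite (eq_bigr (fun t => 2 * (1 + r) * (omega t * ip d (residual (V t) x y))
  - omega t * ((1 + r) * ip d d))); last by move=> t _; ring.
rewrite [leRHS](eq_bigr (fun t => 2 * (omega t * ip (x - y)
  (residual (V t) x y)))); last by move=> t _; rewrite mulrCA.
rewrite sumrB -!mulr_sumr -mulr_suml -!ipdE omega1.
lra.
Qed.

(** With [a = x - y] and [d] the residual, [|a - lambda d|^2 = |a|^2 - lambda (2 <a, d> - lambda
    |d|^2)], and the bracket is nonnegative up to [lambda = 1 + r]. *)
Lemma relaxation_nonexpansive lambda r T x y :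
  cocoercive_residual r T -> 0 <= lambda <= 1 + r ->
  `|relaxation lambda T x - relaxation lambda T y| <= `|x - y|.
Proof.
move=> Tr /andP[lambda_ge0 le_r]; rewrite ler_norm_ip relaxationB.
have := Tr x y; have := ip_ge0 (residual T x y).
move: (x - y) (residual T x y) => a d d_ge0 le_d.
have : lambda * (lambda * ip d d) <= lambda * (2 * ip a d).
  by rewrite ler_wpM2l// (le_trans _ le_d)// ler_wpM2r.
by rewrite !ipE (ipC d a); lra.
Qed.

(** * Distance estimates for the perturbed iterates *)

(** [|c - d|^2 - |a - b|^2] equals [|b - d|^2 + |a - c|^2] plus twice the gap in the hypothesis. *)
Lemma expanding_step a b c d :
  ip (a - d) (a - c) <= ip (a - b) (b - d) -> `|a - b| <= `|c - d|.
Proof.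
rewrite ler_norm_ip; have := ip_ge0 (b - d); have := ip_ge0 (a - c).
rewrite !ipE ?(ipC b a) ?(ipC c a) ?(ipC c b) ?(ipC d a) ?(ipC d b) ?(ipC d c).
lra.
Qed.

Lemma ip_subgradient_direction g p c (delta : R) : 0 <= delta -> g != 0 ->
  (forall c', `|c' - c| <= delta -> ip g (c' - p) < 0) ->
  delta < ip (- (`|g|^-1 *: g)) (c - p).
Proof.
move=> delta_ge0 g_neq0 ip_lt0.
have g_gt0 : 0 < `|g| by rewrite normr_gt0.
(* The point of the closed ball around [c] farthest in the direction [g] gives the sharpest
   bound. *)
have := ip_lt0 (c + (delta / `|g|) *: g).
rewrite addrAC subrr add0r normrZ normrM normfV normr_id.
rewrite (ger0_norm delta_ge0) divfK ?gt_eqF// => /(_ (lexx _)).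
rewrite -[c + _ - p]addrAC ipDr ipZr -sqr_normE.
rewrite expr2 mulrA divfK ?gt_eqF// => lt0.
rewrite ipNl ipZl -mulrN ltr_pdivlMl//; lra.
Qed.

Lemma closer_step v p c (delta beta : R) : `|v| <= 1 -> delta < ip v (c - p) ->
  0 < beta < delta -> `|p + beta *: v - c| < `|p - c|.
Proof.
move=> v_le1 lt_ip /andP[beta_gt0 beta_lt]; rewrite ltr_norm_ip.
have -> : p + beta *: v - c = beta *: v - (c - p) by rewrite opprB addrCA addrA.
have -> : p - c = - (c - p) by rewrite opprB.
have : ip v v <= 1 by rewrite -sqr_normE expr_le1.
move: (c - p) lt_ip => u lt_ip v_le.
have : beta * (beta * ip v v) < beta * (2 * ip v u).
  rewrite ltr_pM2l//; have : beta * ip v v <= beta * 1 by rewrite ler_pM2l.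
  lra.
rewrite !ipE (ipC u v); lra.
Qed.

(** The total step length below [delta] keeps all inner iterates where [phi] exceeds [a], so at each
    of them [closer_step] applies with centre [c]. *)
Lemma superiorized_perturbation_closer phi Top lambda N beta s v y0 y c k
    (delta a : R) :
  superiorized_algorithm ip phi Top lambda N beta s v y0 y ->
  (forall z, `|z - y k| < delta -> a < phi z) ->
  (forall z, `|z - c| <= delta -> phi z < a) ->
  \sum_(1 <= n < (N k).+1) beta k n < delta ->
  `|perturbed beta v y k (N k) - c| < `|y k - c|.
Proof.
move=> alg phi_gt phi_lt sum_lt.
have beta_gt0 := superiorized_beta_gt0 alg (k := k).
have v_le1 n : (n < N k)%N -> `|v k n.+1| <= 1.
  move=> n_lt.
  have [s0|s0] := pselect (subdifferential ip phi (perturbed beta v y k n) 0).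
    by rewrite (superiorized_direction0 alg n_lt s0) normr0.
  rewrite (superiorized_direction alg n_lt s0) normrN normrZ normfV normr_id.
  by have [->|s_neq0] := eqVneq `|s k n| 0; rewrite ?mulr0// mulVf.
have perturbedS n : perturbed beta v y k n.+1
    = perturbed beta v y k n + beta k n.+1 *: v k n.+1.
  by rewrite /perturbed [in LHS]big_nat_recr//= addrA.
have perturbed0 : perturbed beta v y k 0 = y k.
  by rewrite /perturbed big_geq// addr0.
have sum_mono n : (n <= N k)%N ->
    \sum_(1 <= i < n.+1) beta k i <= \sum_(1 <= i < (N k).+1) beta k i.
  move=> n_le; rewrite [leRHS](@big_cat_nat _ _ _ n.+1)//= lerDl big_nat_cond.
  apply: sumr_ge0 => i; rewrite andbT => /andP[lt_i i_le].
  by rewrite ltW// beta_gt0// (leq_trans _ lt_i).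
have dist_le n : (n <= N k)%N -> `|perturbed beta v y k n - y k|
    <= \sum_(1 <= i < n.+1) beta k i.
  elim: n => [|n IH] n_lt.
    by rewrite perturbed0 subrr normr0 big_geq.
  rewrite perturbedS addrAC big_nat_recr//=.
  apply: (le_trans (ler_normD _ _)); apply: lerD; first exact/IH/ltnW.
  have b_gt0 : 0 < beta k n.+1 by exact: beta_gt0.
  by rewrite normrZ gtr0_norm// ger_pMr// v_le1.
have beta_lt n : (n < N k)%N -> beta k n.+1 < delta.
  move=> n_lt; apply: le_lt_trans sum_lt; apply: le_trans (sum_mono _ n_lt).
  rewrite big_nat_recr//= lerDr big_nat_cond.
  apply: sumr_ge0 => i; rewrite andbT => /andP[i_gt i_le].
  by rewrite ltW// beta_gt0// i_gt/= (leq_trans _ n_lt)// ltnW.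
have closer n : (n < N k)%N ->
    `|perturbed beta v y k n.+1 - c| < `|perturbed beta v y k n - c|.
  move=> n_lt; rewrite perturbedS.
  have b_gt0 : 0 < beta k n.+1 by exact: beta_gt0.
  have delta_gt0 : 0 < delta by exact: lt_trans b_gt0 (beta_lt _ n_lt).
  have phi_p : a < phi (perturbed beta v y k n).
    apply: phi_gt; apply: le_lt_trans sum_lt.
    exact: le_trans (dist_le _ (ltnW n_lt)) (sum_mono _ (ltnW n_lt)).
  have phi_c : phi c < a by apply: phi_lt; rewrite subrr normr0 ltW.
  (* The inner iterate does not minimize [phi], as [c] has a smaller value; so the direction is a
     normalized negative subgradient. *)
  have not0 : ~ subdifferential ip phi (perturbed beta v y k n) 0.
    by move=> /(_ c); rewrite linear0l; lra.
  have s_neq0 : s k n != 0.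
    apply/eqP => s0; apply: not0.
    by have := superiorized_subgradient alg n_lt; rewrite s0.
  apply: (@closer_step _ _ _ delta); rewrite ?v_le1 ?b_gt0 ?beta_lt//.
  rewrite (superiorized_direction alg n_lt not0).
  apply: ip_subgradient_direction => //; first exact: ltW.
  move=> c' /phi_lt phi_c'.
  have := superiorized_subgradient alg n_lt c'.
  lra.
have closer0 n : (n < N k)%N ->
    `|perturbed beta v y k n.+1 - c| < `|y k - c|.
  elim: n => [|n IH] n_lt; first by rewrite -perturbed0; exact: closer.
  exact: lt_trans (closer _ n_lt) (IH (ltnW n_lt)).
(* Strictness needs at least one inner step. *)
have := superiorized_N_gt0 alg k; case: (N k) closer0 => // n closer0 _.
exact: closer0.
Qed.

End InnerProduct.

(** * Bounds on [max_seq] and [rho] *)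

Lemma max_seq_ge (q : nat -> nat) :
  (exists B, forall k, (q k <= B)%N) -> forall k, (q k <= max_seq q)%N.
Proof.
move=> [B q_le].
have ex : exists M, `[< exists k, q k = M >].
  by exists (q 0%N); apply/asboolP; exists 0%N.
have le_B M : `[< exists k, q k = M >] -> (M <= B)%N by move=> /asboolP[k <-].
have [M /asboolP attained M_max] := ex_maxnP ex le_B.
rewrite /max_seq; case: xgetP => [_ _ [_ //]|/(_ M) []].
by split=> // k; apply: M_max; apply/asboolP; exists k.
Qed.

Lemma rho_ge0 (R : realType) m (alpha : 'I_m.+1 -> R) q :
  (forall i, 0 < alpha i <= 2) -> 0 <= rho alpha q.
Proof.
move=> alpha_itv.
have r_ge0 i : 0 <= (2 - alpha i) * (alpha i)^-1.
  by have /andP[? ?] := alpha_itv i; rewrite divr_ge0 ?subr_ge0// ltW.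
rewrite /rho le_min ler01 andbT mulr_ge0 ?invr_ge0 ?ler0n//.
by apply: le_bigmin.
Qed.

(** The factor [n] lost by a string of length [n] is absorbed by the inverse of [max_seq q] in
    [rho], as [string_op_residual] requires. *)
Lemma rho_le (R : realType) m (alpha : 'I_m.+1 -> R) q (n : nat) i :
  (forall i, 0 < alpha i <= 2) -> (0 < n <= max_seq q)%N ->
  n%:R * rho alpha q <= (2 - alpha i) * (alpha i)^-1.
Proof.
move=> alpha_itv /andP[n_gt0 n_le].
have M_gt0 : 0 < (max_seq q)%:R :> R by rewrite ltr0n (leq_trans n_gt0).
apply: (@le_trans _ _ ((max_seq q)%:R * rho alpha q)).
  by rewrite ler_wpM2r ?rho_ge0// ler_nat.
rewrite -ler_pdivlMl// /rho ge_min; apply/orP; left.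
rewrite ler_pM2l ?invr_gt0//; exact: bigmin_le.
Qed.

Theorem corollary3p4 (R : realType) (H : completeNormedModType R)
    (ip : {dot H for idfun}) (ip_norm : induces_norm ip)
    (m : nat) (U : 'I_m.+1 -> H -> H) (alpha : 'I_m.+1 -> R)
    (alpha_itv : forall i, 0 < alpha i <= 2)
    (U_rfne : forall i, relaxed_firmly_nonexpansive ip (alpha i) (U i))
    (q : nat -> nat) (q_gt0 : forall k, (0 < q k)%N)
    (q_bounded : exists B : nat, forall k, (q k <= B)%N)
    (Omega : forall k, {set {ffun 'I_(q k) -> 'I_m.+1}})
    (Omega_neq0 : forall k, Omega k != finset.set0)
    (omega : forall k, {ffun 'I_(q k) -> 'I_m.+1} -> R)
    (omega_weight : forall k, is_weight (Omega k) (omega k))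
    (Top := fun k => string_avg U (Omega k) (omega k))
    (phi : H -> R) (phi_convex : convex_function [set: H] phi)
    (phi_continuous : continuous phi)
    (epsilon : R) (epsilon_gt0 : 0 < epsilon)
    (lambda : nat -> R)
    (lambda_itv : forall k, epsilon <= lambda k <= 1 + rho alpha q - epsilon)
    (x0 : H) (xs : nat -> H)
    (xs_basic : basic_algorithm Top lambda x0 xs)
    (x : H) (x_C : common_fix Top x) (xs_cvg : xs @ \oo --> x)
    (N : nat -> nat) (beta : nat -> nat -> R) (s v : nat -> nat -> H)
    (y0 : H) (ys : nat -> H)
    (ys_superiorized :
       superiorized_algorithm ip phi Top lambda N beta s v y0 ys)
    (y : H) (y_C : common_fix Top y) (ys_cvg : ys @ \oo --> y)
    (gamma : nat -> nat)
    (gamma_increasing : forall i j, (i < j)%N -> (gamma i < gamma j)%N)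
    (gamma_ineq : forall k,
       let g := gamma k in
       let Tg := relaxation (lambda g) (Top g) in
       ip (ys g - Tg (xs g)) (ys g - Tg (perturbed beta v ys g (N g)))
         <= ip (ys g - xs g) (xs g - Tg (xs g))) :
  phi y <= phi x.
Proof.
have rho_ge := rho_ge0 _ _ _ q alpha_itv.
have q_le := max_seq_ge q q_bounded.
have Top_residual k : cocoercive_residual _ _ ip (rho alpha q) (Top k).
  apply: weighted_sum_residual => //; first by rewrite addr_ge0.
  move=> t; apply: string_op_residual => // i.
  have /andP[alpha_gt0 _] := alpha_itv i.
  apply: (cocoercive_residual_le _ _ _ _
    (relaxed_firmly_nonexpansive_residual _ _ _ ip_norm _ _
       alpha_gt0 (U_rfne i))).
  by apply: rho_le => //; rewrite q_gt0 q_le.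
rewrite leNgt; apply/negP => phi_lt.
(* A level strictly between the two values separates neighbourhoods of [x] and [y]. *)
pose a := (phi x + phi y) / 2.
have /nbhs_ballP[dx /= dx_gt0 phi_x] : \forall z \near x, phi z < a.
  by apply: cvgr_lt (phi_continuous x) _ _; rewrite /a; lra.
have /nbhs_ballP[dy /= dy_gt0 phi_y] : \forall z \near y, a < phi z.
  by apply: cvgr_gt (phi_continuous y) _ _; rewrite /a; lra.
(* Halving leaves room for [delta]-balls around the moving points [xs g] and [ys g], themselves
   within [delta] of the limits. *)
pose delta := Num.min dx dy / 2.
have delta_gt0 : 0 < delta by rewrite divr_gt0// lt_min dx_gt0.
have delta_x : delta + delta <= dx by rewrite /delta -splitr ge_min lexx.
have delta_y : delta + delta <= dy by rewrite /delta -splitr ge_min lexx orbT.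
have sum_cvg := cvg_series_cvg_0 (superiorized_beta_summable ys_superiorized).
have [K _ near_limits] : \forall k \near \oo,
    [/\ `|x - xs k| < delta, `|y - ys k| < delta &
       `|0 - \sum_(1 <= n < (N k).+1) beta k n| < delta].
  near=> k; split; near: k.
  - exact: cvgr_dist_lt xs_cvg _ delta_gt0.
  - exact: cvgr_dist_lt ys_cvg _ delta_gt0.
  - exact: cvgr_dist_lt sum_cvg _ delta_gt0.
(* Thus [gamma K] is past the threshold [K], and this single index yields the contradiction. *)
have gamma_ge k : (k <= gamma k)%N.
  elim: k => // k IH.
  exact: leq_ltn_trans IH (gamma_increasing _ _ (ltnSn k)).
have := near_limits _ (gamma_ge K); move: (gamma_ineq K) => /=.
move: (gamma K) => g ineq [xs_near ys_near sum_lt].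
(* The centre is the current iterate [xs g], not the limit [x], so that nonexpansiveness can be
   compared with [ineq]. *)
have closer : `|perturbed beta v ys g (N g) - xs g| < `|ys g - xs g|.
  apply: (superiorized_perturbation_closer _ _ _ ip_norm
    _ _ _ _ _ _ _ _ _ _ _ delta a ys_superiorized) => [z z_near|z z_near|].
  - apply: phi_y; rewrite -ball_normE /= (le_lt_trans (ler_distD (ys g) _ _))//.
    by rewrite (lt_le_trans _ delta_y)// ltrD// distrC.
  - apply: phi_x; rewrite -ball_normE /= (le_lt_trans (ler_distD (xs g) _ _))//.
    by rewrite (lt_le_trans _ delta_x)// ltr_leD// distrC.
  - by apply: le_lt_trans sum_lt; rewrite sub0r normrN ler_norm.
have lambda_le : 0 <= lambda g <= 1 + rho alpha q.
  by have /andP[? ?] := lambda_itv g; apply/andP; split; lra.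
have := relaxation_nonexpansive _ _ _ ip_norm _ _ _
  (perturbed beta v ys g (N g)) (xs g) (Top_residual g) lambda_le.
have := expanding_step _ _ _ ip_norm _ _ _ _ ineq.
move=> le1 le2; have := le_lt_trans (le_trans le1 le2) closer.
by rewrite ltxx.
Unshelve. all: by end_near.
Qed.
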